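(* Let $n\ge1$ and let $\pi\in S_{n+1}$ be almost consecutive, i.e. $|\pi^{-1}(i+1)-\pi^{-1}(i)|\le 2$ for all $i\in[n]$. Let $f:\mathbb{R}\to\mathbb{R}$ be a symmetric density function (i.e. $f(-x)=f(x)$ for all $x$) of a continuous probability distribution. Then \[ \mathbb{P}(f,\pi)=\frac{1}{2^n\prod_{i=1}^n \mathrm{lev}(\pi)_i}. \]
   Context: Random walk setup: for a probability density $f$ of a continuous distribution, let $X_1,\dots,X_n$ be independent random variables with density $f$, and let $Z_1=0$ and $Z_i=X_1+\cdots+X_{i-1}$ for $2\le i\le n+1$. The ordinal pattern of a tuple $(z_1,\dots,z_{n+1})$ of distinct reals is the permutation $\pi\in S_{n+1}$ with $\pi(i)=|\{j: z_i\ge z_j\}|$. $\mathbb{P}(f,\pi)$ is the probability that $(Z_1,\dots,Z_{n+1})$ has ordinal pattern $\pi$. For $j\in[n]$, $\mathrm{lev}(\pi)_j$ is the number of $i\in[n]$ with $\pi(i)\le j<\pi(i+1)$ or $\pi(i+1)\le j<\pi(i)$. *)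

(* Defs.v *)
From mathcomp Require Import all_boot all_order all_fingroup all_algebra.
From mathcomp Require Import all_classical all_reals all_analysis.

Set Implicit Arguments.
Unset Strict Implicit.
Unset Printing Implicit Defensive.

Import Order.TTheory GRing.Theory Num.Theory.
Import numFieldNormedType.Exports.

Local Open Scope classical_set_scope.
Local Open Scope ring_scope.

(* Positions and values are 0-based throughout: i : 'I_n.+1 stands for
   i + 1 in [n + 1], and i : 'I_n stands for i + 1 in [n].  For i : 'I_n,
   [pos i] and [succ_pos i] are the consecutive elements i and i + 1 of 'I_n.+1. *)
Definition pos n (i : 'I_n) : 'I_n.+1 := widen_ord (leqnSn n) i.
Definition succ_pos n (i : 'I_n) : 'I_n.+1 := lift ord0 i.

Definition almost_consecutive n (pi : 'S_n.+1) : Prop :=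
  forall i : 'I_n,
    (`|(pi^-1)%g (succ_pos i) - (pi^-1)%g (pos i)| <= 2)%N.

(* In 1-based terms: pi(i) <= j + 1 < pi(i+1) iff, in 0-based values,
   pi(i) <= j < pi(i+1). *)
Definition lev n (pi : 'S_n.+1) (j : 'I_n) : nat :=
  #|[set i : 'I_n | (pi (pos i) <= j < pi (succ_pos i))%N
                 || (pi (succ_pos i) <= j < pi (pos i))%N]%SET|.

(* If two entries of z coincide, their counts coincide too, so no permutation
   is a pattern of z: only tuples of distinct reals have a pattern. *)
Definition has_ordinal_pattern (R : realType) n (z : 'I_n.+1 -> R)
    (pi : 'S_n.+1) : Prop :=
  forall i, (pi i).+1 = #|[set j | z j <= z i]%SET|.

Definition is_density (R : realType) (f : R -> R) : Prop :=
  [/\ measurable_fun setT f, forall x, 0 <= f x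
    & (\int[@lebesgue_measure R]_x (f x)%:E = 1)%E].

Section random_walk.
Context d (T : measurableType d) (R : realType) (P : probability T R).

Definition has_density (X : {RV P >-> R}) (f : R -> R) : Prop :=
  forall A : set R, measurable A ->
    distribution P X A = (\int[@lebesgue_measure R]_(x in A) (f x)%:E)%E.

Definition mutually_independent (I : finType) (X : I -> {RV P >-> R}) : Prop :=
  forall (J : {set I}) (A : I -> set R), (forall i, measurable (A i)) ->
    P (\bigcap_(i in [set` J]) (X i @^-1` A i)) =
    (\prod_(i in J) P (X i @^-1` A i))%E.

Definition walk n (X : 'I_n -> {RV P >-> R}) (i : 'I_n.+1) (w : T) : R :=
  \sum_(k < n | (k < i)%N) X k w.

Definition pattern_prob n (X : 'I_n -> {RV P >-> R}) (pi : 'S_n.+1) : \bar R :=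
  P [set w | has_ordinal_pattern (fun i => walk X i w) pi].

End random_walk.

(* Main.v *)
Require Import Defs.
From HB Require Import structures.
From mathcomp Require Import all_boot all_order all_fingroup all_algebra.
From mathcomp Require Import zify lra.
From mathcomp Require Import all_classical all_reals all_analysis.
From mathcomp Require Import measurable_realfun.
Import Order.TTheory GRing.Theory Num.Theory.
Import numFieldNormedType.Exports.

(* Let [V i] be the step [X i] multiplied by the sign of [pi (i+1) - pi i]; the
   [V i] are again independent with density [f].  The walk has pattern [pi] iff
   its values increase along [pi^-1 0, pi^-1 1, ...].  Since consecutive values
   sit at positions at distance at most 2, each of these n inequalities says
   either [0 < V i] or [V j < V i] for two neighbouring edges [i] and [j].
   Assign to level [k] the edge [r k] crossing it between the positions of the
   values [k] and [k+1], and let [B k] be the set of all edges crossing [k], so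
   that [#|B k| = lev k].  The sets [B k] form a laminar family, and the pattern
   is [pi] iff all [V i] are positive and each [V (r k)] is the strict minimum
   of [V] on [B k].

   The probability of the latter is a hook length product: the signs contribute
   [2^-n], and when the levels are treated by decreasing [#|B k|], the
   conditions already imposed are invariant under permutations of [B k], so by
   exchangeability each element of [B k] is equally likely to be the minimum,
   and each level contributes a factor [1 / #|B k|]. *)

Set Implicit Arguments.
Unset Strict Implicit.

(** * Edges, levels and the root of a level *)

(* [p] and [q] stand for [pi] and [pi^-1], read as functions on [0, n]. *)
Section Levels.
Local Open Scope nat_scope.
Variables (n : nat) (p q : nat -> nat).
Hypothesis p_le : forall i, i <= n -> p i <= n.
Hypothesis q_le : forall v, v <= n -> q v <= n.
Hypothesis pK : forall i, i <= n -> q (p i) = i.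
Hypothesis qK : forall v, v <= n -> p (q v) = v.
Hypothesis q_step : forall v, v < n -> q v.+1 <= q v + 2 /\ q v <= q v.+1 + 2.

Definition crosses i k := (p i <= k < p i.+1) || (p i.+1 <= k < p i).

Definition level_root k i := crosses i k && (minn (q k) (q k.+1) <= i < maxn (q k) (q k.+1)).

(** The path between the positions of [k] and [k.+1] has one or two edges and passes from one side
    of level [k] to the other. *)
Lemma level_root_exists k : k < n -> exists2 i, i < n & level_root k i.
Proof.
move=> kn; have [qk qk1] : q k <= n /\ q k.+1 <= n by split; apply: q_le; lia.
have [st1 st2] := q_step kn.
have pk : p (q k) = k by apply: qK; lia.
have pk1 : p (q k.+1) = k.+1 by apply: qK; lia.
have nq : q k <> q k.+1 by move=> e; move: pk1; rewrite -e pk; lia.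
rewrite /level_root /crosses.
set m := minn (q k) (q k.+1).
have [e|e] : q k = m \/ q k.+1 = m by lia.
- have [e2|e2] : q k.+1 = m.+1 \/ q k.+1 = m.+2 by lia.
    by exists m; move: pk pk1; rewrite ?e ?e2; lia.
  move: pk pk1; rewrite ?e ?e2 => pk pk1.
  case: (leqP (p m.+1) k) => h; [exists m.+1|exists m]; lia.
- have [e2|e2] : q k = m.+1 \/ q k = m.+2 by lia.
    by exists m; move: pk pk1; rewrite ?e ?e2; lia.
  move: pk pk1; rewrite ?e ?e2 => pk pk1.
  case: (leqP (p m.+1) k) => h; [exists m|exists m.+1]; lia.
Qed.

(** If two distinct edges qualified, the position between them would hold a value both above level
    [k] and not above it. *)
Lemma level_root_uniq k i j : k < n -> level_root k i -> level_root k j -> i = j.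
Proof.
wlog ij : i j / i < j.
  move=> H kn hi hj.
  have [ij|[ij|//]] : i < j \/ j < i \/ i = j by lia.
    exact: H.
  by apply/esym/H.
move=> kn; have [st1 st2] := q_step kn.
have pk : p (q k) = k by apply: qK; lia.
have pk1 : p (q k.+1) = k.+1 by apply: qK; lia.
rewrite /level_root /crosses => hi hj; have ej : j = i.+1 by lia.
have [[e e']|[e e']] : (q k = i /\ q k.+1 = i.+2) \/ (q k = i.+2 /\ q k.+1 = i) by lia.
all: by move: pk pk1 hi hj; rewrite e e' ej; lia.
Qed.

Lemma exists_crossing (P : nat -> bool) a b : a <= b -> P a -> ~~ P b ->
  exists v, [/\ a <= v, v < b, P v & ~~ P v.+1].
Proof.
move=> ab Pa Pb; have [m hm] : exists m, b = a + m by exists (b - a); lia.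
elim: m b hm ab Pb => [|m IH] b hm ab Pb.
  by move: Pb; rewrite (_ : b = a) ?Pa//; lia.
have eb : b = (a + m).+1 by lia.
case h : (P (a + m)); last first.
  by have [||//|v [? ? ? ?]] := IH (a + m); [by []|lia|rewrite h|exists v; split => //; lia].
by exists (a + m); split; rewrite -?eb //; lia.
Qed.

(* The values strictly between [p i] and [p i.+1] are visited in increasing order
   without using the positions [i] and [i.+1]; steps of length at most 2
   cannot jump over the edge, so one end of it is two positions away from a
   neighbouring value. *)
Lemma crosses_peel i : i < n -> exists2 k, k < n & level_root k i /\
  ((forall l, crosses i l -> l = k) \/
   exists m, [/\ m < n, m <> i, ~~ crosses m k &
     forall l, crosses i l = (l == k) || crosses m l]).
Proof.
move=> lt_in.
have [pi pi1] : p i <= n /\ p i.+1 <= n by split; apply: p_le; lia.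
have qi : q (p i) = i by apply: pK; lia.
have qi1 : q (p i.+1) = i.+1 by apply: pK; lia.
have npp : p i <> p i.+1 by move=> e; move: qi1; rewrite -e qi; lia.
pose lo := minn (p i) (p i.+1); pose hi := maxn (p i) (p i.+1).
have [hi1|hi1] : hi = lo.+1 \/ lo.+1 < hi by lia.
  exists lo; first by lia.
  split; last by left => l; rewrite /crosses; lia.
  have [[e1 e2]|[e1 e2]] : (p i = lo /\ p i.+1 = lo.+1) \/ (p i = lo.+1 /\ p i.+1 = lo) by lia.
    by move: qi qi1; rewrite /level_root /crosses e1 e2; lia.
  by move: qi qi1; rewrite /level_root /crosses e1 e2; lia.
have qne v : lo < v -> v < hi -> q v <> i /\ q v <> i.+1.
  move=> h1 h2; have pv : p (q v) = v by apply: qK; lia.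
  by split=> e; move: pv; rewrite e; lia.
(* [m] is a position just outside edge [i] whose value is adjacent to the value at the farther end
   of the edge; [k] is the level separating these two values. *)
have vnear : exists k m, [/\ k < n, crosses i k, m <= n & m.+1 = i \/ m = i.+2] /\
    ((k = lo /\ p m = lo.+1 /\ ((m = i.+2 /\ q lo = i /\ p i = lo) \/ (m.+1 = i /\ q lo = i.+1 /\ p i.+1 = lo)))
   \/ (k.+1 = hi /\ p m = k /\ ((m = i.+2 /\ q hi = i /\ p i = hi) \/ (m.+1 = i /\ q hi = i.+1 /\ p i.+1 = hi)))).
  have qlo1 : p (q lo.+1) = lo.+1 by apply: qK; lia.
  have qhi1 : p (q hi.-1) = hi.-1 by apply: qK; lia.
  have qlo1n : q lo.+1 <= n by apply: q_le; lia.
  have qhi1n : q hi.-1 <= n by apply: q_le; lia.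
  have [sl1 sl2] := q_step (v := lo) ltac:(lia).
  have [] := q_step (v := hi.-1) ltac:(lia).
  rewrite (_ : hi.-1.+1 = hi); last by lia.
  move=> sh1 sh2.
  have [n1 n2] := qne lo.+1 ltac:(lia) ltac:(lia).
  have [n3 n4] := qne hi.-1 ltac:(lia) ltac:(lia).
  have [e|e] : (lo = p i /\ hi = p i.+1) \/ (lo = p i.+1 /\ hi = p i) by lia.
  - have el : q lo = i by rewrite (proj1 e).
    have eh : q hi = i.+1 by rewrite (proj2 e).
    have [c|c] := eqVneq (q lo.+1) i.+2.
      by exists lo, i.+2; rewrite -c; split; [split; rewrite /crosses; lia|lia].
    have [c'|c'] := eqVneq (q hi.-1).+1 i.
      by exists hi.-1, (q hi.-1); split; [split; rewrite /crosses; lia|lia].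
    (* Otherwise [lo.+1] sits before the edge and [hi.-1] after it, and some step between
       consecutive values jumps from below [i] to above [i.+1], a length of at least 3. *)
    have [v [v1 v2 v3 v4]] := @exists_crossing (fun v => q v < i) lo.+1 hi.-1
      ltac:(lia) ltac:(lia) ltac:(lia).
    have := q_step (v := v) ltac:(lia); have := qne v.+1 ltac:(lia) ltac:(lia); lia.
  - have el : q lo = i.+1 by rewrite (proj1 e).
    have eh : q hi = i by rewrite (proj2 e).
    have [c|c] := eqVneq (q lo.+1).+1 i.
      by exists lo, (q lo.+1); split; [split; rewrite /crosses; lia|lia].
    have [c'|c'] := eqVneq (q hi.-1) i.+2.
      by exists hi.-1, i.+2; rewrite -c'; split; [split; rewrite /crosses; lia|lia].
    have [v [v1 v2 v3 v4]] := @exists_crossing (fun v => i < q v) lo.+1 hi.-1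
      ltac:(lia) ltac:(lia) ltac:(lia).
    have := q_step (v := v) ltac:(lia); have := qne v ltac:(lia) ltac:(lia).
    by have := qne v.+1 ltac:(lia) ltac:(lia); lia.
have [k [m [[kn ck mn me] hm]]] := vnear.
have qm : q (p m) = m by apply: pK.
exists k => //; split.
  rewrite /level_root ck /=.
  case: hm => [[-> [e]]|[e1 [e]]]; first by rewrite -e qm; lia.
  by rewrite e1 -e qm; lia.
(* The edge from [m] to the nearer end of edge [i] spans the same levels except [k]. *)
right; exists (if m < i then m else i.+1).
case: me hm => me hm.
  have -> : (m < i) = true by lia.
  split; try lia.
    by rewrite /crosses me; lia.
  by move=> l; rewrite /crosses me; lia.
have -> : (m < i) = false by lia.
move: hm mn qm; rewrite me => hm mn qm; split; try lia.
  by rewrite /crosses; lia.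
by move=> l; rewrite /crosses; lia.
Qed.

(** * Nesting of edges and laminarity *)

Definition width i := maxn (p i) (p i.+1) - minn (p i) (p i.+1).

(** The levels crossed by an edge form an interval, so the inclusion need only be tested at its
    lowest and highest level. *)
Lemma crosses_width i j k : (forall l, crosses j l -> crosses i l) ->
  crosses i k -> ~~ crosses j k -> width j < width i.
Proof.
rewrite /width => sub.
have := sub (minn (p j) (p j.+1)); have := sub (maxn (p j) (p j.+1)).-1.
by rewrite /crosses; lia.
Qed.

(** Suited to [crosses_peel]: removing a level there leads to a narrower edge. *)
Lemma edge_ind (Q : nat -> Prop) :
  (forall i, i < n -> (forall j, j < n -> width j < width i -> Q j) -> Q i) ->
  forall i, i < n -> Q i.
Proof.
move=> H i; have [w] := ubnP (width i).
elim: w i => // w IH i wi lt_in; apply: H => // j jn ji; apply: IH => //; lia.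
Qed.

(** The root of [l] is the innermost edge over [l]: peeling levels off [j] until [l] itself is
    removed ends at [i], and each peel only shrinks the set of crossed levels. *)
Lemma crosses_root_sub j l i k : j < n -> crosses j l -> level_root l i ->
  crosses i k -> crosses j k.
Proof.
move=> jn; move: j jn l i k; apply: edge_ind => j jn IH l i k jl li ik.
have [k' k'n [rk' H]] := crosses_peel jn.
have [elk|nlk] := eqVneq l k'.
  by rewrite elk in li; rewrite (level_root_uniq k'n rk' li).
case: H => [H|[m [mn mj mk' H]]]; first by rewrite (H l jl) eqxx in nlk.
rewrite H; apply/orP; right; apply: (IH m mn _ l i k) => //.
  apply: (@crosses_width _ _ k') => //; last by case/andP: rk'.
  by move=> l' ml'; rewrite H ml' orbT.
by move: jl; rewrite H (negbTE nlk).
Qed.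

(** Peel [x] until the first of [k] and [l] is removed: the edge reached is the root of that level
    and still crosses the other one. *)
Lemma crosses_root_total x k l i j : x < n -> k != l -> crosses x k ->
  crosses x l -> level_root k i -> level_root l j ->
  crosses i l \/ crosses j k.
Proof.
move=> xn; move: x xn k l i j; apply: edge_ind => x xn IH k l i j kl xk xl ki lj.
have [k' k'n [rk' H]] := crosses_peel xn.
have [ek|nk] := eqVneq k k'.
  by left; rewrite -(level_root_uniq k'n rk' (_ : level_root k' i)) -?ek.
have [el|nl] := eqVneq l k'.
  by right; rewrite -(level_root_uniq k'n rk' (_ : level_root k' j)) -?el.
case: H => [H|[m [mn mj mk' H]]]; first by rewrite (H l xl) eqxx in nl.
apply: (IH m mn _ k l i j) => //.
- apply: (@crosses_width _ _ k') => //; last by case/andP: rk'.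
  by move=> l' ml'; rewrite H ml' orbT.
- by move: xk; rewrite H (negbTE nk).
- by move: xl; rewrite H (negbTE nl).
Qed.

(** If each root crossed the other level, both would cross exactly the same levels. The neighbour
    [m] obtained by peeling [i] still crosses [k] or [l] but misses a level, against the minimality
    of roots in [crosses_root_sub]. *)
Lemma crosses_root_asym k l i j : i < n -> j < n -> k != l ->
  level_root k i -> level_root l j -> crosses i l -> ~~ crosses j k.
Proof.
move=> ltin jn kl ki lj il; apply/negP => jk.
have ik : crosses i k by case/andP: ki.
have jl : crosses j l by case/andP: lj.
have sub x : crosses i x = crosses j x.
  apply/idP/idP => h; first exact: (crosses_root_sub jn jk ki h).
  exact: (crosses_root_sub ltin il lj h).
have [k' k'n [rk' H]] := crosses_peel ltin.
case: H => [H|[m [mn mi mk' H]]].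
  by rewrite (H k ik) (H l il) eqxx in kl.
have ik' : crosses i k' by case/andP: rk'.
have [e|nk] := eqVneq k k'.
  have ml : crosses m l by move: il; rewrite H -e eq_sym (negbTE kl).
  by rewrite (crosses_root_sub mn ml lj (_ : crosses j k')) -?sub in mk'.
have mk : crosses m k by move: ik; rewrite H (negbTE nk).
by rewrite (crosses_root_sub mn mk ki (_ : crosses i k')) in mk'.
Qed.

(** An edge over both levels makes one root cross the other level; minimality of that root gives the
    inclusion, and asymmetry keeps the outer root out of the inner set. *)
Lemma crosses_laminar k l i j : i < n -> j < n -> k != l ->
    level_root k i -> level_root l j ->
  [\/ forall x, x < n -> ~~ (crosses x k && crosses x l),
      (forall x, x < n -> crosses x k -> crosses x l) /\ ~~ crosses j k |
      (forall x, x < n -> crosses x l -> crosses x k) /\ ~~ crosses i l].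
Proof.
move=> ltin jn kl ki lj.
case: (boolP (has (fun x => crosses x k && crosses x l) (iota 0 n))).
  move=> /hasP[x]; rewrite mem_iota => /= xn /andP[xk xl].
  have [il|jk] := crosses_root_total xn kl xk xl ki lj.
    apply: Or32; split; last exact: crosses_root_asym lj il.
    by move=> y yn yk; apply: crosses_root_sub yn yk ki il.
  apply: Or33; split; last by apply: crosses_root_asym ki jk; rewrite // eq_sym.
  by move=> y yn yl; apply: crosses_root_sub yn yl lj jk.
move/hasPn => H; apply: Or31 => x xn; apply: H.
by rewrite mem_iota.
Qed.

(** * Increasing walks as conditions on gaps *)

(** The increment along edge [i], signed so that a walk with pattern [p] makes it positive; for the
    random walk it is [V i]. *)
Definition gap (R : realDomainType) (z : nat -> R) i : R :=
  (if (p i < p i.+1)%N then z i.+1 - z i else z i - z i.+1)%R.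

(** Forwards, a gap is the increase of [z] over the interval of values its edge spans, and the root
    of a level spans the smallest such interval. Backwards, each inequality is recovered from the
    root of [k] and at most one neighbouring edge. *)
Lemma increasing_iff_gaps (R : realDomainType) (z : nat -> R) :
  (forall v, v < n -> (z (q v) < z (q v.+1))%R) <->
  (forall i, i < n -> (0 < gap z i)%R) /\
  (forall k i j, k < n -> j < n -> level_root k i -> crosses j k -> j != i ->
     (gap z i < gap z j)%R).
Proof.
split=> [zlt|[gap0 gaplt] k kn].
  have zq a b : a < b -> b <= n -> (z (q a) < z (q b))%R.
    elim: b => // b IH; rewrite ltnS leq_eqVlt => /orP[/eqP->|ab] bn.
      exact: zlt.
    by apply: lt_trans (IH ab (ltnW bn)) (zlt _ bn).
  have zqle a b : a <= b -> b <= n -> (z (q a) <= z (q b))%R.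
    by rewrite leq_eqVlt => /orP[/eqP->//|ab bn]; apply/ltW/zq.
  pose hi i := maxn (p i) (p i.+1); pose lo i := minn (p i) (p i.+1).
  have bnd i : i < n -> [/\ lo i < hi i, hi i <= n &
      (gap z i = z (q (hi i)) - z (q (lo i)))%R].
    move=> ltin; rewrite /lo /hi /gap.
    have [p0 p1] : p i <= n /\ p i.+1 <= n by split; apply: p_le; lia.
    have [q0 q1] : q (p i) = i /\ q (p i.+1) = i.+1 by split; apply: pK; lia.
    have : p i <> p i.+1 by move=> e; move: q1; rewrite -e q0; lia.
    by case: (ltnP (p i) (p i.+1)) => h ne; rewrite q0 q1; split => //; lia.
  split=> [i ltin|k i j kn jn ki jk ji].
    by have [h1 h2 ->] := bnd i ltin; rewrite subr_gt0 zq.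
  have ltin : i < n.
    have := q_le (v := k); have := q_le (v := k.+1).
    by move: ki; rewrite /level_root; lia.
  have [i1 i2 ->] := bnd i ltin; have [j1 j2 ->] := bnd j jn.
  have sub x : crosses i x -> crosses j x.
    exact: crosses_root_sub jn jk ki.
  have := sub (lo i); have := sub (hi i).-1.
  rewrite /crosses => s1 s2.
  have hle : hi i <= hi j by move: s1 s2; rewrite /hi /lo in i1 *; lia.
  have lle : lo j <= lo i by move: s1 s2; rewrite /hi /lo in i1 *; lia.
  have [|e1] := ltnP (hi i) (hi j) => [hlt|].
    by have := zq _ _ hlt j2; have := zqle _ _ lle ltac:(lia); lra.
  have [|e2] := ltnP (lo j) (lo i) => [llt|].
    by have := zq _ _ llt ltac:(lia); have := zqle _ _ hle j2; lra.
  (* Equal spans force equal edges, because [p] is injective. *)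
  have qq y : y < n -> q (p y) = y /\ q (p y.+1) = y.+1 by move=> yn; split; apply: pK; lia.
  have [qi qi1] := qq i ltin; have [qj qj1] := qq j jn.
  have [[e e']|[e e']] : (p i = p j /\ p i.+1 = p j.+1) \/ (p i = p j.+1 /\ p i.+1 = p j).
    by move: hle lle e1 e2; rewrite /hi /lo; lia.
    by move: ji; rewrite -qi -qj e eqxx.
  by move: qi qi1; rewrite e e' qj qj1; lia.
have [i ltin ki] := level_root_exists kn.
have [qk qk1] : q k <= n /\ q k.+1 <= n by split; apply: q_le; lia.
have pk : p (q k) = k by apply: qK; lia.
have pk1 : p (q k.+1) = k.+1 by apply: qK; lia.
have [st1 st2] := q_step kn.
have nq : q k <> q k.+1 by move=> e; move: pk1; rewrite -e pk; lia.
(* Such an [m] is itself the root of some level, and [i] crosses that level too. *)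
have other m : m < n -> m != i -> (forall x, crosses m x -> crosses i x) ->
    (gap z m < gap z i)%R.
  move=> mn mi sub; have [k' k'n [rk' _]] := crosses_peel mn.
  by apply: (gaplt k') => //; [apply: sub; case/andP: rk'|rewrite eq_sym].
have pne x : x <= n -> x <> q k -> x <> q k.+1 -> p x <> k /\ p x <> k.+1.
  by move=> xn h1 h2; have := pK xn; split=> e; move: H; rewrite e; lia.
have gi := gap0 i ltin.
move: ki; rewrite /level_root => /andP[ck bet].
(* Either the root alone joins the positions of [k] and [k.+1], or a second edge lies between them.
   It runs in the opposite direction, so [z (q k.+1) - z (q k)] is the gap of the root minus that of
   the second edge. *)
have [d1|d1] : (q k = i /\ q k.+1 = i.+1 \/ q k.+1 = i /\ q k = i.+1) \/
  ((q k = i /\ q k.+1 = i.+2) \/ (q k.+1 = i /\ q k = i.+2) \/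
   (q k = i.+1 /\ i = (q k.+1).+1) \/ (q k.+1 = i.+1 /\ i = (q k).+1)) by lia.
  move: gi pk pk1; rewrite /gap; case: d1 => -[-> ->] gi pk pk1.
    by move: gi; rewrite pk pk1 ltnSn subr_gt0.
  by move: gi; rewrite pk pk1 ltnNge leqnSn /= subr_gt0.
case: d1 => [[e e']|[[e e']|[[e e']|[e e']]]].
- move: pk pk1 pne; rewrite e e' => pk pk1 pne.
  have [v1 v2] := pne i.+1 ltac:(lia) ltac:(lia) ltac:(lia).
  have := other i.+1 ltac:(lia) ltac:(lia) ltac:(by move=> x; move: ck; rewrite /crosses; lia).
  have h1 : (p i < p i.+1) = true by move: ck; rewrite /crosses; lia.
  have h2 : (p i.+1 < p i.+2) = false by move: ck; rewrite /crosses; lia.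
  by rewrite /gap h1 h2 ltrD2l ltrN2.
- move: pk pk1 pne; rewrite e e' => pk pk1 pne.
  have [v1 v2] := pne i.+1 ltac:(lia) ltac:(lia) ltac:(lia).
  have := other i.+1 ltac:(lia) ltac:(lia) ltac:(by move=> x; move: ck; rewrite /crosses; lia).
  have h1 : (p i < p i.+1) = false by move: ck; rewrite /crosses; lia.
  have h2 : (p i.+1 < p i.+2) = true by move: ck; rewrite /crosses; lia.
  by rewrite /gap h1 h2 ltrD2r.
- move: pk pk1 pne ck gi other; rewrite e e'; set m := q k.+1 => pk pk1 pne ck gi other.
  have [v1 v2] := pne m.+1 ltac:(lia) ltac:(lia) ltac:(lia).
  have := other m ltac:(lia) ltac:(lia) ltac:(by move=> x; move: ck; rewrite /crosses; lia).
  have h1 : (p m < p m.+1) = true by move: ck; rewrite /crosses; lia.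
  have h2 : (p m.+1 < p m.+2) = false by move: ck; rewrite /crosses; lia.
  by rewrite /gap h1 h2 ltrD2l ltrN2.
- move: pk pk1 pne ck gi other; rewrite e e'; set m := q k => pk pk1 pne ck gi other.
  have [v1 v2] := pne m.+1 ltac:(lia) ltac:(lia) ltac:(lia).
  have := other m ltac:(lia) ltac:(lia) ltac:(by move=> x; move: ck; rewrite /crosses; lia).
  have h1 : (p m < p m.+1) = false by move: ck; rewrite /crosses; lia.
  have h2 : (p m.+1 < p m.+2) = true by move: ck; rewrite /crosses; lia.
  by rewrite /gap h1 h2 ltrD2r.
Qed.

End Levels.

Local Open Scope classical_set_scope.
Local Open Scope ring_scope.

(** * The product sigma-algebra on finite families of reals *)

Definition boxes (R : realType) (I : finType) : set (set (I -> R)) :=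
  [set C | exists2 A : I -> set R,
     (forall i, measurable (A i)) & C = [set x | forall i, A i (x i)]].

Definition box_space (R : realType) (I : finType) :
    measurableType (sigma_display (@boxes R I)) :=
  g_sigma_algebraType (@boxes R I).

Lemma setI_closed_boxes (R : realType) (I : finType) : setI_closed (@boxes R I).
Proof.
move=> _ _ [A mA ->] [B mB ->]; exists (fun i => A i `&` B i).
  by move=> i; exact: measurableI.
apply/seteqP; split => x /=; first by case=> a b i.
by move=> h; split=> i; have [] := h i.
Qed.

Lemma measurable_coordinate (R : realType) (I : finType) (i : I) :
  measurable_fun setT (fun x : box_space R I => x i : R).
Proof.
move=> _ A mA; rewrite setTI; apply: sub_sigma_algebra.
exists (fun j => if j == i then A else setT).
  by move=> j; case: ifP.
apply/seteqP; split => x /= h; first by move=> j; case: eqP => // ->.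
by have := h i; rewrite eqxx.
Qed.


Lemma measurable_family d (T : measurableType d) (R : realType) (I : finType)
    (V : I -> T -> R) :
  (forall i, measurable_fun setT (V i)) ->
  measurable_fun setT ((fun w i => V i w) : T -> box_space R I).
Proof.
move=> mV. refine (@measurability d _ T (box_space R I) _ _ (@boxes R I) erefl _).
move=> _ [_ [A mA ->] <-]; rewrite setTI.
rewrite (_ : _ @^-1` _ = \bigcap_i (V i @^-1` A i)).
  apply: fin_bigcap_measurable => // i _.
  by rewrite -[X in measurable X]setTI; exact: mV.
by apply/seteqP; split => w /= h i; [move=> _|]; apply: h.
Qed.

(** * Exchangeability and absence of ties for independent identically distributed families *)

Section Exchangeable.
Context d (T : measurableType d) (R : realType) (P : probability T R).
Context (I : finType) (V : I -> T -> R) (mu : set R -> \bar R).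
Hypothesis mV : forall i, measurable_fun setT (V i).
Hypothesis iidV : forall A : I -> set R, (forall i, measurable (A i)) ->
  P (\bigcap_i (V i @^-1` A i)) = (\prod_i mu (A i))%E.

(** Boxes are stable under intersection and generate the sigma-algebra, so the two laws need only
    agree on boxes; there both are the same product up to reindexing by [s]. *)
Lemma iid_exchangeable (s : {perm I}) (C : set (box_space R I)) :
  measurable C -> P [set w | C (fun i => V (s i) w)] = P [set w | C (V^~ w)].
Proof.
move=> mC.
have mVs i : measurable_fun setT (V (s i)) by exact: mV.
pose F : {mfun T >-> box_space R I} :=
  HB.pack (fun w i => V i w) (isMeasurableFun.Build _ _ _ _ _ (measurable_family mV)).
pose G : {mfun T >-> box_space R I} :=
  HB.pack (fun w i => V (s i) w) (isMeasurableFun.Build _ _ _ _ _ (measurable_family mVs)).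
apply: (@measure_unique _ R (box_space R I) (@boxes R I) (fun=> setT) _ _ _ _
  (distribution P G) (distribution P F)) => //.
- exact: setI_closed_boxes.
- move=> _; exists (fun=> setT) => //.
  by apply/seteqP; split.
- by apply/seteqP; split => // x _; exists 0%N.
- move=> _ [A mA ->]; rewrite /distribution /pushforward.
  transitivity (P (\bigcap_i (V i @^-1` A ((s^-1)%g i)))).
    congr (P _); apply/seteqP; split => w /= h i.
      by move=> _; have := h ((s^-1)%g i); rewrite permKV.
    by have := h (s i) Logic.I; rewrite /= permK.
  transitivity (P (\bigcap_i (V i @^-1` A i))); last first.
    by congr (P _); apply/seteqP; split => w /= h i; [apply: h|move=> _; apply: h].
  by rewrite !iidV // [RHS](reindex_inj (@perm_inj _ s^-1%g)).
- by move=> _; rewrite (le_lt_trans (probability_le1 _ _)) ?ltry.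
Qed.

Definition strict_argmin (t : I) (A : {set I}) : set (box_space R I) :=
  [set x | forall j, j \in A -> j != t -> x t < x j].

Lemma measurable_strict_argmin t A : measurable (strict_argmin t A).
Proof.
rewrite (_ : strict_argmin t A =
    \bigcap_(j in [set j | (j \in A) && (j != t)]) [set x | x t < x j]); last first.
  apply/seteqP; split => x /= h j; first by move=> /andP[jA jt]; apply: h.
  by move=> jA jt; apply: h; rewrite /= jA jt.
apply: fin_bigcap_measurable => // j _.
have := measurable_fun_ltr (measurable_coordinate (R:=R) t) (measurable_coordinate j).
move=> /(_ measurableT [set true] Logic.I); rewrite setTI.
by congr measurable; apply/seteqP; split => x /=; move=> ->.
Qed.

Hypothesis mu_setT : mu setT = 1%E.
Hypothesis mu_atomless : forall x, mu [set x] = 0%E.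

Lemma iid_marginal i A : measurable A -> P (V i @^-1` A) = mu A.
Proof.
move=> mA; pose Ak k := if k == i then A else setT.
have mAk k : measurable (Ak k) by rewrite /Ak; case: ifP.
have := iidV mAk; rewrite /Ak.
rewrite (bigD1 i) //= eqxx big1 ?mule1 => [<-|k /negbTE->//].
congr (P _); apply/seteqP; split => w /= h; last by have := h i Logic.I; rewrite /= eqxx.
by move=> k _ /=; case: eqP => [->|].
Qed.

Lemma iid_pair i j A B : i != j -> measurable A -> measurable B ->
  P ((V i @^-1` A) `&` (V j @^-1` B)) = (mu A * mu B)%E.
Proof.
move=> ij mA mB; have ji : j != i by rewrite eq_sym.
pose Ak k := if k == i then A else if k == j then B else setT.
have mAk k : measurable (Ak k) by rewrite /Ak; do 2?case: ifP.
have := iidV mAk; rewrite /Ak.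
rewrite (bigD1 i) //= eqxx (bigD1 j ji) /= eqxx (negbTE ji).
rewrite big1 ?mule1 => [<-|k /andP[/negbTE-> /negbTE->]//].
congr (P _); apply/seteqP; split => w /= h.
  by case: h => hi hj k _ /=; case: eqP => [->|_] //; case: eqP => [->|].
split; first by have := h i Logic.I; rewrite /= eqxx.
by have := h j Logic.I; rewrite /= eqxx (negbTE ji).
Qed.

(** The joint law of two coordinates is the product of the marginals, and every section of the
    diagonal is a singleton, hence null. *)
Lemma no_ties i j : i != j -> P [set w | V i w = V j w] = 0%E.
Proof.
move=> ij.
pose X : {mfun T >-> R} := HB.pack (V i) (isMeasurableFun.Build _ _ _ _ _ (mV i)).
pose Y : {mfun T >-> R} := HB.pack (V j) (isMeasurableFun.Build _ _ _ _ _ (mV j)).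
have mXY : measurable_fun setT (fun w => (V i w, V j w)) by exact: measurable_fun_pair.
pose F : {mfun T >-> (R * R)%type} :=
  HB.pack (fun w => (V i w, V j w)) (isMeasurableFun.Build _ _ _ _ _ mXY).
pose D := [set xy : R * R | xy.1 = xy.2].
have mD : measurable D.
  have := measurable_fun_eqr (@measurable_fst _ _ R R) (@measurable_snd _ _ R R).
  move=> /(_ measurableT [set true] Logic.I); rewrite setTI.
  by congr measurable; apply/seteqP; split => w /= /eqP.
have prodE A B : measurable A -> measurable B ->
    distribution P F (A `*` B) = (distribution P X A * distribution P Y B)%E.
  move=> mA mB; rewrite [RHS](_ : _ = mu A * mu B)%E; last first.
    by congr (_ * _)%E; exact: iid_marginal.
  by rewrite -(iid_pair ij mA mB).
rewrite -[LHS]/(distribution P F D) -(product_measure_unique prodE) //.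
rewrite /product_measure1 integral0_eq // => x _ /=.
rewrite (_ : xsection D x = [set x]) ?[LHS]iid_marginal //.
by apply/seteqP; split => y; rewrite /xsection /= inE.
Qed.

Lemma negligible_ties :
  exists2 N, measurable N /\ P N = 0%E &
    forall w, ~ N w -> forall i j, i != j -> V i w != V j w.
Proof.
pose tie (ij : I * I) := [set w | V ij.1 w = V ij.2 w].
have mtie ij : measurable (tie ij).
  have := measurable_fun_eqr (mV ij.1) (mV ij.2).
  move=> /(_ measurableT [set true] Logic.I); rewrite setTI.
  by congr measurable; apply/seteqP; split => w /= /eqP.
exists (\big[setU/set0]_(ij : I * I | ij.1 != ij.2) tie ij).
  elim/big_rec : _ => [|ij N nij [mN N0]]; first by split => //; rewrite measure0.
  by split; [exact: measurableU|rewrite measureU0 //; exact: no_ties].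
move=> w Nw i j ij; apply/eqP => e; apply: Nw.
by rewrite (bigD1 (i, j)) //; left.
Qed.

(** * The hook length product for a laminar family of blocks *)

Context (K : finType) (B : K -> {set I}) (r : K -> I).
Hypothesis root_in : forall k, r k \in B k.
Hypothesis laminar : forall k l, k != l ->
  [\/ [disjoint B k & B l]%B, (B k \subset B l) && (r l \notin B k) |
      (B l \subset B k) && (r k \notin B l)].
Variable C0 : set (box_space R I).
Hypothesis mC0 : measurable C0.
Hypothesis C0_perm : forall (s : {perm I}) x, C0 x -> C0 (fun i => x (s i)).

Definition roots_min (S : {set K}) : set (box_space R I) :=
  C0 `&` \bigcap_(k in [set` S]) strict_argmin (r k) (B k).

Lemma measurable_roots_min S : measurable (roots_min S).
Proof.
apply: measurableI => //; apply: fin_bigcap_measurable => // k _.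
exact: measurable_strict_argmin.
Qed.

(* As [#|B s|] is minimal, laminarity leaves two cases for every other block:
   it is disjoint from [B s], or it contains [B s] and its root is outside. *)
Lemma roots_min_tperm (S : {set K}) s t x : s \notin S ->
    (forall k, k \in S -> (#|B s| <= #|B k|)%N) -> t \in B s ->
  roots_min S x -> roots_min S (fun i => x (tperm (r s) t i)).
Proof.
move=> sS minS tB [c0 h]; split; first exact: C0_perm.
move=> k /= kS; have := h k kS; rewrite /strict_argmin /= => hk.
have ks : k != s by apply: contraNneq sS => <-.
(* Hence the transposition of [r s] and [t] preserves membership in [B k] and fixes [r k]. *)
have inB y z : y \in B s -> z \in B s -> (y \in B k) = (z \in B k) /\
    (y != r k).
  case: (laminar ks) => [dis|/andP[sub nin]|/andP[sub nin]] ys zs.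
  - have yk u : u \in B s -> u \notin B k.
      by move=> us; apply/negP => uk; have := disjointFr dis uk; rewrite us.
    rewrite !(negbTE (yk _ _)) //; split => //; apply/eqP => e;
      by move: (yk _ ys); rewrite e root_in.
  - have := minS k kS; rewrite leqNgt => /negP[]; apply: proper_card.
    by apply/properP; split => //; exists (r s).
  - by rewrite (fintype.subsetP sub y ys) (fintype.subsetP sub z zs); split => //; apply/eqP => e; move: nin; rewrite -e ys.
have rs := root_in s.
have [_ rk1] := inB _ _ rs rs; have [_ tk1] := inB _ _ tB tB.
have [e _] := inB _ _ rs tB.
move=> j jB jr.
rewrite (tpermD rk1 tk1); apply: hk.
  by case: tpermP jB => [->|->|//]; rewrite e.
by case: tpermP.
Qed.

(** Almost surely exactly one [t] in [B s] carries the strict minimum. Swapping [r s] and [t]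
    preserves the conditions for [S], so all these [t] are equally likely. *)
Lemma roots_min_step (S : {set K}) s : s \notin S ->
    (forall k, k \in S -> (#|B s| <= #|B k|)%N) ->
  P [set w | roots_min S (V^~ w)] =
    (#|B s|%:R%:E * P [set w | roots_min (s |: S) (V^~ w)])%E.
Proof.
move=> sS minS.
pose M t := [set w | (roots_min S `&` strict_argmin t (B s)) (V^~ w)].
have mpre (C : set (box_space R I)) : measurable C -> measurable [set w | C (V^~ w)].
  move=> mC; rewrite -[X in measurable X]setTI.
  exact: (measurable_family mV) measurableT _ mC.
have mM t : measurable (M t).
  apply: mpre; apply: measurableI; first exact: measurable_roots_min.
  exact: measurable_strict_argmin.
have MS : M (r s) = [set w | roots_min (s |: S) (V^~ w)].
  apply/seteqP; split => w.
    case=> -[c0 h] hs; split => // k /=; rewrite !inE => /orP[/eqP->//|kS].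
    exact: h.
  case=> c0 h; split; last by apply: h; rewrite /= !inE eqxx.
  by split => // k kS; apply: h; rewrite /= !inE kS orbT.
have PM t : t \in B s -> P (M t) = P (M (r s)).
  move=> tB; rewrite /M -[RHS](iid_exchangeable (tperm (r s) t)); last first.
    apply: measurableI; first exact: measurable_roots_min.
    exact: measurable_strict_argmin.
  congr (P _); apply/seteqP; split => w [hS ht]; split.
  - exact: (roots_min_tperm sS minS tB hS).
  - move=> j jB jr /=; rewrite tpermL; apply: ht.
      by case: tpermP => // ->.
    by case: tpermP jr => [-> /eqP //|->|_ /eqP //]; rewrite eq_sym.
  - have := roots_min_tperm sS minS tB hS.
    by congr roots_min; apply/funext => i /=; rewrite tpermK.
  - move=> j jB jt /=; have := ht (tperm (r s) t j).
    rewrite /= tpermL tpermK; apply.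
      by case: tpermP => // ->.
    by case: tpermP jt => [->|-> /eqP //|/eqP //]; rewrite eq_sym.
have [N [mN PN] hN] := negligible_ties.
pose A := [set w | roots_min S (V^~ w)].
have mA : measurable A by apply: mpre; exact: measurable_roots_min.
(* Off the null set [N] of ties, a minimiser over [B s] is strict. *)
have AM : A = \bigcup_(t in [set` B s]) M t `|` (A `&` N).
  apply/seteqP; split => w; last by case=> [[t _ []]|[]].
  move=> Aw; have [Nw|Nw] := pselect (N w); [by right|left].
  have [t tB tmin] := arg_minP (V^~ w) (root_in s).
  exists t => //; split => // j jB jt /=.
  by rewrite lt_neqAle eq_sym hN //; exact: tmin.
have UM : measurable (\bigcup_(t in [set` B s]) M t).
  by apply: fin_bigcup_measurable => // t _; exact: mM.
have trM : trivIset [set` B s] M.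
  move=> t u /= tB uB [w [[_ ht] [_ hu]]]; apply/eqP/negP => /negP tu.
  by have := lt_trans (ht u uB _) (hu t tB tu); rewrite ltxx eq_sym tu => /(_ isT).
transitivity (P (\bigcup_(t in [set` B s]) M t)).
  have mAN : measurable (A `&` N) by exact: measurableI.
  rewrite -[LHS]/(P A) AM measureU0 //.
  by apply: (@subset_measure0 _ _ _ P _ N) => // w [].
rewrite measure_fin_bigcup // -MS.
rewrite (_ : [set` B s] = [set` enum (B s)]); last first.
  by apply/seteqP; split => t /=; rewrite mem_enum.
rewrite -fsbig_seq ?enum_uniq // big_seq (eq_bigr (fun=> P (M (r s)))); last first.
  by move=> t; rewrite mem_enum => /PM.
by rewrite -big_seq big_enum /= sumr_const mule_natl.
Qed.

(** Induction on the size of [S]: the block removed is a smallest one, as [roots_min_step]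
    requires. *)
Lemma roots_min_prob (S : {set K}) :
  P [set w | roots_min S (V^~ w)] =
    (P [set w | C0 (V^~ w)] * (\prod_(k in S) (#|B k|%:R)^-1)%:E)%E.
Proof.
have [m] := ubnP #|S|; elim: m S => // m IH S cS.
have [->|[s0 s0S]] := set_0Vmem S.
  rewrite big_set0 mule1; congr (P _); apply/seteqP; split => w.
    by case.
  by move=> c0; split => // k /=; rewrite inE.
have [s /= sS smin] := arg_minnP (fun k => #|B k|) s0S.
have {}sS : s \in S by [].
have := roots_min_step (S := S :\ s) (s := s).
rewrite !inE eqxx finset.setD1K // => /(_ isT) step.
have {}step := step ltac:(by move=> k; rewrite !inE => /andP[_]; exact: smin).
rewrite IH in step; last by move: cS; rewrite (cardsD1 s S) sS.
have B0 : #|B s|%:R != 0 :> R.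
  by rewrite pnatr_eq0 -lt0n; apply/card_gt0P; exists (r s).
rewrite (big_setD1 s) //= EFinM muleCA step muleA -EFinM mulVf // mul1e.
by [].
Qed.
End Exchangeable.

(** * Symmetric densities *)

Lemma density_opp (R : realType) (f : R -> R) (A : set R) :
  is_density f -> (forall x, f (- x) = f x) -> measurable A ->
  (\int[@lebesgue_measure R]_(x in -%R @^-1` A) (f x)%:E =
   \int[@lebesgue_measure R]_(x in A) (f x)%:E)%E.
Proof.
move=> [mf f0 _] fN mA.
under [LHS]eq_integral do rewrite -fN.
rewrite -(@ge0_integral_pushforward _ _ (measurableTypeR R) (measurableTypeR R) R -%R _
   (@lebesgue_measure R) A (EFin \o f)) //=; last 2 first.
- exact: measurable_funS (measurableT_comp _ mf).
- by move=> y _; rewrite lee_fin.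
by apply: eq_measure_integral => //= B mB AB; exact: lebesgue_measureN.
Qed.

Lemma density_pos_half (R : realType) (f : R -> R) :
  is_density f -> (forall x, f (- x) = f x) ->
  (\int[@lebesgue_measure R]_(x in [set x : R | (0 < x)%R]) (f x)%:E = (2^-1)%:E)%E.
Proof.
move=> df fN; have [mf f0 f1] := df.
have mpos : measurable [set x : R | (0 < x)%R].
  by rewrite (_ : [set x : R | (0 < x)%R] = `]0, +oo[%classic) //;
    apply/seteqP; split => x /=; rewrite in_itv /= andbT.
set p := (\int[_]_(x in _) _)%E.
have negE : (\int[@lebesgue_measure R]_(x in [set x : R | (x < 0)%R]) (f x)%:E = p)%E.
  rewrite /p -[RHS]density_opp //; congr (integral _ _ _).
  by apply/seteqP; split => x /=; rewrite oppr_gt0.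
have mneg : measurable [set x : R | (x < 0)%R].
  by rewrite (_ : [set x : R | (x < 0)%R] = `]-oo, 0[%classic) //;
    apply/seteqP; split => x /=; rewrite in_itv.
have mfe (D : set R) : measurable_fun D (EFin \o f).
  by apply: measurable_funS (measurableT_comp _ mf).
have mzero : measurable [set 0%R : R] by exact: measurable_set1.
have mposneg := measurableU _ _ mpos mneg.
have : (p + p = 1)%E.
  rewrite -f1 (_ : setT = ([set x : R | (0 < x)%R] `|` [set x : R | (x < 0)%R]) `|` [set 0%R]); last first.
    by apply/seteqP; split => // x _ /=; case: (ltgtP x 0%R) => [h|h|->]; [left; right|left; left|right].
  rewrite ge0_integral_setU //=; last 3 first.
  - exact: mfe.
  - by move=> x _; rewrite lee_fin.
  - by rewrite disj_set2E; apply/eqP/seteqP; split => x // [[] /= h e]; move: h; rewrite e ltxx.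
  rewrite ge0_integral_setU //=; last 3 first.
  - exact: mfe.
  - by move=> x _; rewrite lee_fin.
  - rewrite disj_set2E; apply/eqP/seteqP; split => x // [/= h1 h2].
    by have := lt_trans h1 h2; rewrite ltxx.
  by rewrite negE integral_set1 adde0.
(* The equation [p + p = 1] rules out infinite values of [p]. *)
clear negE; clearbody p; case: p => [x| |] // => -[] e; congr (_%:E).
by lra.
Qed.

(** * Ordinal patterns and steps of the walk *)

Lemma card_ord_le n (m : 'I_n.+1) : #|[set v : 'I_n.+1 | (v <= m)%N]%SET| = m.+1.
Proof.
rewrite -sum1dep_card.
rewrite (eq_bigl (fun v : 'I_n.+1 => (v < m.+1)%N)); last by move=> v; rewrite ltnS.
by rewrite -(big_ord_widen n.+1 (fun=> 1%N)) // sum1_card card_ord.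
Qed.

(** A failed inequality would make the rank [v.+2] at most [v.+1], since counting is monotone.
    Conversely, if [z] increases along values, the entries at most [z i] are those whose value under
    [pi] is at most [pi i]. *)
Lemma has_ordinal_patternP (R : realType) n (z : 'I_n.+1 -> R) (pi : 'S_n.+1) :
  has_ordinal_pattern z pi <->
  forall v, (v < n)%N -> z ((pi^-1)%g (inord v)) < z ((pi^-1)%g (inord v.+1)).
Proof.
split=> [zpi v vn|zlt i].
  rewrite ltNge; apply/negP => zle.
  have := zpi ((pi^-1)%g (inord v.+1)); have := zpi ((pi^-1)%g (inord v)).
  rewrite !permKV !inordK ?ltnS // 1?ltnW // => e1 e2.
  suff: (v.+2 <= v.+1)%N by rewrite ltnn.
  apply: leq_trans (eq_leq e2) _; rewrite [leqRHS]e1; apply/subset_leq_card/fintype.subsetP => j.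
  by rewrite !inE => h; exact: le_trans h zle.
have zq a b : (a < b)%N -> (b <= n)%N ->
    z ((pi^-1)%g (inord a)) < z ((pi^-1)%g (inord b)).
  elim: b => // b IH; rewrite ltnS leq_eqVlt => /orP[/eqP->|ab] bn.
    exact: zlt.
  by apply: lt_trans (IH ab (ltnW bn)) (zlt _ bn).
have zpi a b : (pi a < pi b)%N -> z a < z b.
  move=> ab; have := zq (pi a) (pi b) ab; rewrite !inord_val !permK; apply.
  by rewrite -ltnS.
rewrite -(card_ord_le (pi i)) -[RHS](card_imset _ (@perm_inj _ pi)).
congr (#|pred_of_set _|); apply/setP => v; rewrite inE.
apply/idP/imsetP => [vi|[j]].
  exists ((pi^-1)%g v); last by rewrite permKV.
  rewrite inE; move: vi; rewrite leq_eqVlt => /orP[/eqP e|vi].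
    by rewrite (_ : v = pi i) ?permK //; exact: val_inj.
  by apply/ltW/zpi; rewrite permKV.
rewrite inE => zji ->; rewrite leqNgt; apply/negP => /zpi.
by rewrite ltNge zji.
Qed.

Lemma walk_step d (T : measurableType d) (R : realType) (P : probability T R) n
    (X : 'I_n -> {RV P >-> R}) (i : 'I_n) w :
  walk X (inord i.+1) w - walk X (inord i) w = X i w.
Proof.
rewrite /walk !inordK ?ltnS ?(ltnW (ltn_ord i)) ?ltn_ord //.
rewrite (bigD1 i) ?ltnSn //=.
rewrite (eq_bigl (fun k : 'I_n => (k < i)%N)) ?addrK // => k.
by rewrite ltnS ltn_neqAle andbC.
Qed.

Lemma inord_succ_pos n (i : 'I_n) : inord i.+1 = succ_pos i.
Proof. by apply: val_inj; rewrite /= inordK // ltnS. Qed.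

Lemma inord_pos n (i : 'I_n) : inord i = pos i.
Proof. by apply: val_inj; rewrite /= inordK // ltnW // ltnS. Qed.

(** * Signed steps of the walk and the pattern event *)

Theorem theorem4p9 (R : realType) (n : nat) (pi : 'S_n.+1) (f : R -> R)
    (d : measure_display) (T : measurableType d) (P : probability T R)
    (X : 'I_n -> {RV P >-> R}) :
  (1 <= n)%N ->
  almost_consecutive pi ->
  is_density f ->
  (forall x, f (- x) = f x) ->
  mutually_independent X ->
  (forall i, has_density (X i) f) ->
  pattern_prob X pi = (1 / (2 ^+ n * \prod_(i < n) (lev pi i)%:R))%:E.
Proof.
move=> _ ac df fN indX denX.
(* [inord] sends arguments beyond [n] to 0; the combinatorial hypotheses constrain [p] and [q] only
   up to [n]. *)
pose p x : nat := pi (inord x); pose q v : nat := (pi^-1)%g (inord v).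
have p_le i : (i <= n)%N -> (p i <= n)%N by move=> _; rewrite -ltnS; exact: ltn_ord.
have q_le v : (v <= n)%N -> (q v <= n)%N by move=> _; rewrite -ltnS; exact: ltn_ord.
have pK i : (i <= n)%N -> q (p i) = i.
  by move=> ltin; rewrite /q /p inord_val permK inordK.
have qK v : (v <= n)%N -> p (q v) = v.
  by move=> vn; rewrite /q /p inord_val permKV inordK.
have q_step v : (v < n)%N -> (q v.+1 <= q v + 2)%N /\ (q v <= q v.+1 + 2)%N.
  move=> vn; have := ac (Ordinal vn).
  by rewrite -inord_succ_pos -inord_pos -/(q v) -/(q v.+1) /=; lia.
have ex_root (k : 'I_n) : exists i : 'I_n, level_root p q k i.
  have [i ltin ki] := level_root_exists q_le qK q_step (ltn_ord k).
  by exists (Ordinal ltin).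
pose r k := xchoose (ex_root k).
have rP (k : 'I_n) : level_root p q k (r k) by exact: (xchooseP (ex_root k)).
pose B (k : 'I_n) := [set i : 'I_n | crosses p i k]%SET.
have cardB k : #|B k| = lev pi k.
  apply: eq_card => i; rewrite !inE /crosses /p inord_succ_pos inord_pos.
  by [].
have root_in k : r k \in B k by rewrite inE; case/andP: (rP k).
have laminar k l : k != l ->
    [\/ [disjoint B k & B l]%B, (B k \subset B l) && (r l \notin B k) |
      (B l \subset B k) && (r k \notin B l)].
  move=> kl; have [dis|[sub nr]|[sub nr]] := crosses_laminar p_le q_le pK qK q_step
    (ltn_ord (r k)) (ltn_ord (r l)) kl (rP k) (rP l).
  - apply: Or31; rewrite finset.disjoints_subset; apply/fintype.subsetP => i.
    by rewrite !inE => ik; have := dis i (ltn_ord i); rewrite ik.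
  - apply: Or32; rewrite !inE nr andbT; apply/fintype.subsetP => i.
    by rewrite !inE; exact: sub.
  - apply: Or33; rewrite !inE nr andbT; apply/fintype.subsetP => i.
    by rewrite !inE; exact: sub.
pose up (i : 'I_n) := (p i < p i.+1)%N.
pose V (i : 'I_n) w := if up i then X i w else - X i w.
have mV i : measurable_fun setT (V i).
  by rewrite /V; case: (up i) => //; exact: measurable_funN.
pose mu (A : set R) := (\int[@lebesgue_measure R]_(x in A) (f x)%:E)%E.
have iidV (A : 'I_n -> set R) : (forall i, measurable (A i)) ->
    P (\bigcap_i (V i @^-1` A i)) = (\prod_i mu (A i))%E.
  (* On a descending edge [V i] lies in [A i] iff [X i] lies in the reflected set, which has the
     same mass by symmetry of [f]. *)
  move=> mA; pose A' i := if up i then A i else -%R @^-1` A i.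
  have mA' i : measurable (A' i).
    rewrite /A'; case: ifP => // _; rewrite -[X in measurable X]setTI.
    exact: measurable_funN (@measurable_id _ _ _) measurableT _ (mA i).
  have := indX [set: 'I_n]%SET A' mA'.
  rewrite (eq_bigl xpredT); last by move=> i; rewrite inE.
  rewrite (eq_bigr (fun i => mu (A i))); last first.
    move=> i _; rewrite -[LHS]/(distribution P (X i) (A' i)) denX // /A'.
    by case: ifP => // _; exact: density_opp.
  move=> <-; congr (P _); apply/seteqP; split => w /= h i.
    by move=> _; have := h i Logic.I; rewrite /V /A'; case: ifP.
  by move=> _; have := h i; rewrite /= inE /V /A' => /(_ isT); case: ifP.
have muT : mu setT = 1%E by case: df.
have mu1 x : mu [set x] = 0%E by exact: integral_set1.
(* The positivity condition is a box, hence measurable, and it is invariant under every permutation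
   of the coordinates. *)
pose C0 : set (box_space R 'I_n) := [set x | forall i, [set y | 0 < y] (x i)].
have mpos : measurable [set y : R | 0 < y].
  by rewrite (_ : [set y | 0 < y] = `]0, +oo[%classic) //;
    apply/seteqP; split => y /=; rewrite in_itv /= andbT.
have mC0 : measurable C0.
  by apply: sub_sigma_algebra; exists (fun=> [set y | 0 < y]).
have C0_perm (s : {perm 'I_n}) x : C0 x -> C0 (fun i => x (s i)) by move=> h i; apply: h.
have := roots_min_prob mV iidV muT mu1 root_in laminar mC0 C0_perm [set: 'I_n]%SET.
rewrite [X in (X * _)%E](_ : _ = ((2^-1) ^+ n)%:E); last first.
  transitivity (P (\bigcap_i (V i @^-1` [set y | 0 < y]))).
    by congr (P _); apply/seteqP; split => w /= h i; [move=> _|]; apply: h.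
  rewrite iidV // (eq_bigr (fun=> (2^-1)%:E)); last by move=> i _; exact: density_pos_half.
  by rewrite prodEFin prodr_const card_ord.
rewrite -EFinM (eq_bigl xpredT); last by move=> i; rewrite inE.
have -> : 2^-1 ^+ n * (\prod_k (#|B k|%:R)^-1) =
    1 / (2 ^+ n * \prod_(i < n) (lev pi i)%:R) :> R.
  rewrite div1r invfM exprVn -prodfV; congr (_ * _).
  by apply: eq_bigr => k _; rewrite cardB.
move=> <-; rewrite /pattern_prob; congr (P _); apply/seteqP.
pose z w x := walk X (inord x) w.
have Vgap w (i : 'I_n) : V i w = gap p (z w) i.
  by rewrite /V /gap /up; case: ifP => _; rewrite -walk_step // opprB.
have patE w : has_ordinal_pattern (fun i => walk X i w) pi <->
    forall v, (v < n)%N -> z w (q v) < z w (q v.+1).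
  rewrite has_ordinal_patternP; split => h v vn.
    by rewrite /z /q !inord_val; exact: h.
  by have := h v vn; rewrite /z /q !inord_val.
split=> w /=.
  move/patE/(increasing_iff_gaps p_le q_le pK qK q_step) => [g0 glt]; split.
    by move=> i; rewrite /= Vgap; exact: g0.
  move=> k _ j; rewrite inE => jk jr /=; rewrite !Vgap.
  exact: glt (rP k) jk jr.
move=> [c0 h]; apply/patE/(increasing_iff_gaps p_le q_le pK qK q_step); split.
  by move=> i ltin; have := c0 (Ordinal ltin); rewrite /= Vgap.
move=> k i j kn jn ki jk ji; have := h (Ordinal kn) _ (Ordinal jn).
(* Uniqueness of roots identifies the chosen root with the given one. *)
have er : r (Ordinal kn) = i :> nat.
  by apply: (level_root_uniq qK q_step kn (rP (Ordinal kn))).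
rewrite /= !Vgap /= er inE; apply => //; first by rewrite inE.
by apply: contraNneq ji => e; rewrite -er -e.
Qed.
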